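(* Let $q>3$ be a prime power and let $C$ be an $[n,k,d]_q$ linear code such that $C^{\perp}\subseteq C$ and $\dim(C)-\dim(C^{\perp})=\ell$. Then for each integer $c$ with $0\le c\le \ell$ there exists an $[[n+c,\,2k-n,\,d';\,c]]_q$ EAQECC with $d\le d'\le d+c$.
   Context: An $[n,k,d]_q$ linear code is a $k$-dimensional subspace of $\mathbb{F}_q^n$ with minimum Hamming distance $d$. The Euclidean dual is $C^{\perp}=\{v\in\mathbb{F}_q^n : \sum_i v_iw_i=0\ \forall w\in C\}$. An $[[n,k,d;c]]_q$ entanglement-assisted quantum error-correcting code (EAQECC) encodes $k$ logical qudits into $n$ physical qudits using $c$ copies of maximally entangled states pre-shared between sender and receiver. In standard terms: with $\mathcal{H}=\mathbb{C}^q$ and $\Phi=q^{-1/2}\sum_{i}|i\rangle|i\rangle\in\mathcal{H}\otimes\mathcal{H}$, it is a subspace $Q=\{(U\otimes I)(|\psi\rangle\otimes|0\rangle^{\otimes (n-k-c)}\otimes\Phi^{\otimes c}):\psi\in\mathcal{H}^{\otimes k}\}$ of $\mathcal{H}^{\otimes n}\otimes\mathcal{H}^{\otimes c}$, where $U$ is a unitary on the sender's $n$ qudits (the $k$ data qudits, the $n-k-c$ ancillas and the sender's halves of the $c$ pairs) and $I$ acts on the receiver's $c$ halves, such that, with $P$ the orthogonal projector onto $Q$, for every operator $E$ on $\mathcal{H}^{\otimes n}$ acting nontrivially on at most $d-1$ qudits there is a scalar $\lambda_E$ with $P(E\otimes I)P=\lambda_E P$. *)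

(* Defs.v *)
From HB Require Import structures.
From mathcomp Require Import all_boot all_order all_algebra.
From mathcomp Require Import complex reals.

Set Implicit Arguments.
Unset Strict Implicit.
Unset Printing Implicit Defensive.

Import Order.TTheory GRing.Theory Num.Theory.
Local Open Scope ring_scope.

Section ClassicalCodes.
Variables (F : finFieldType) (n : nat).
Implicit Types (C : {vspace 'rV[F]_n}) (u v w : 'rV[F]_n).

Definition hamming_dist u v : nat := #|[set i | u 0 i != v 0 i]|.

(* No d satisfies this when C = 0: a code with a minimum distance is nonzero. *)
Definition min_distance C (d : nat) : Prop :=
  (exists u v, [/\ u \in C, v \in C, u != v & hamming_dist u v = d]) /\
  (forall u v, u \in C -> v \in C -> u != v -> (d <= hamming_dist u v)%N).

Definition linear_code (k d : nat) C : Prop := \dim C = k /\ min_distance C d.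

Definition euclid w v : F^o := \sum_i v 0 i * w 0 i.

Fact euclid_is_linear w : linear (euclid w).
Proof.
move=> a u v; rewrite /euclid scaler_sumr -big_split; apply: eq_bigr => i _ /=.
by rewrite !mxE mulrDl -mulrA.
Qed.
HB.instance Definition _ w :=
  GRing.isLinear.Build F 'rV[F]_n F^o _ (euclid w) (euclid_is_linear w).

Definition dual_code C : {vspace 'rV[F]_n} :=
  (\bigcap_(w : 'rV[F]_n | w \in C) lker (linfun (euclid w)))%VS.

Lemma mem_dual_code C v :
  reflect (forall w, w \in C -> \sum_i v 0 i * w 0 i = 0) (v \in dual_code C).
Proof.
apply: (iffP idP) => [/subv_bigcapP vC w wC | vC].
  have := vC w wC; rewrite -memvE memv_ker lfunE => /eqP; exact.
apply/subv_bigcapP => w wC; rewrite -memvE memv_ker lfunE.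
by apply/eqP; apply: vC.
Qed.

End ClassicalCodes.

(* The Hilbert space with orthonormal basis indexed by X; the vector f is
   \sum_x f x |x>, and spaces indexed by X * Y stand for tensor products. *)
Notation hilbert C X := ({ffun X -> C^o}) (only parsing).

(* Labels of the computational basis of m qudits. *)
Notation word q m := ({ffun 'I_m -> 'I_q}) (only parsing).

Section Hilbert.
Variables (C : numClosedFieldType) (X : finType).
Implicit Types (f g : hilbert C X) (A : 'End(hilbert C X)).

Definition inner f g : C := \sum_x (f x)^* * g x.

Definition unitary A : Prop :=
  (forall f g, inner (A f) (A g) = inner f g) /\ limg A = fullv.

Definition orthogonal_projector (Q : {vspace hilbert C X}) A : Prop :=
  [/\ limg A = Q, (A \o A)%VF = A & forall f g, inner (A f) g = inner f (A g)].

Definition tensor_power m f : hilbert C {ffun 'I_m -> X} :=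
  [ffun u : {ffun 'I_m -> X} => \prod_(i < m) f (u i)].

End Hilbert.

Section TensorIdentity.
Variables (C : numClosedFieldType) (X Y : finType).

Definition tensor_id_fun (A : 'End(hilbert C X)) (f : hilbert C (X * Y)) :
    hilbert C (X * Y) :=
  [ffun z => A [ffun x => f (x, z.2)] z.1].

Fact tensor_id_fun_linear A : linear (tensor_id_fun A).
Proof.
move=> a f g; apply/ffunP => z; rewrite !ffunE.
rewrite (_ : [ffun x => (a *: f + g) (x, z.2)] =
  a *: [ffun x => f (x, z.2)] + [ffun x => g (x, z.2)]).
  by rewrite linearP !ffunE.
by apply/ffunP => x; rewrite !ffunE.
Qed.
HB.instance Definition _ A :=
  GRing.isLinear.Build C (hilbert C (X * Y)) (hilbert C (X * Y)) _
    (tensor_id_fun A) (tensor_id_fun_linear A).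

(* The operator A (x) I. *)
Definition tensor_id (A : 'End(hilbert C X)) : 'End(hilbert C (X * Y)) :=
  linfun (tensor_id_fun A).

Lemma tensor_idE A f z : tensor_id A f z = A [ffun x => f (x, z.2)] z.1.
Proof. by rewrite lfunE /= ffunE. Qed.

End TensorIdentity.

Section LocalOperators.
Variables (C : numClosedFieldType) (q n : nat) (S : {set 'I_n}).

(* Labels of the basis of the subsystem formed by the qudits in S. *)
Definition subword := {ffun {i : 'I_n | i \in S} -> 'I_q}.

Definition subword_of (x : word q n) : subword := [ffun i => x (val i)].

(* x with its letters at the positions of S replaced by those of y. *)
Definition overwrite (x : word q n) (y : subword) : word q n :=
  [ffun i => if insub i is Some j then y j else x i].

Definition local_fun (A : 'End(hilbert C subword))
    (f : hilbert C (word q n)) : hilbert C (word q n) :=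
  [ffun x => A [ffun y => f (overwrite x y)] (subword_of x)].

Fact local_fun_linear A : linear (local_fun A).
Proof.
move=> a f g; apply/ffunP => x; rewrite !ffunE.
rewrite (_ : [ffun y => (a *: f + g) (overwrite x y)] =
  a *: [ffun y => f (overwrite x y)] + [ffun y => g (overwrite x y)]).
  by rewrite linearP !ffunE.
by apply/ffunP => y; rewrite !ffunE.
Qed.
HB.instance Definition _ A :=
  GRing.isLinear.Build C (hilbert C (word q n)) (hilbert C (word q n)) _
    (local_fun A) (local_fun_linear A).

(* A on the qudits in S, tensored with the identity on the others. *)
Definition local_op (A : 'End(hilbert C subword)) : 'End(hilbert C (word q n)) :=
  linfun (local_fun A).

Lemma local_opE A f x :
  local_op A f x = A [ffun y => f (overwrite x y)] (subword_of x).
Proof. by rewrite lfunE /= ffunE. Qed.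

End LocalOperators.

Definition acts_within (C : numClosedFieldType) (q n : nat) (S : {set 'I_n})
    (E : 'End(hilbert C (word q n))) : Prop :=
  exists A : 'End(hilbert C (subword q S)), E = local_op A.

Section EAQECC.
Variables (C : numClosedFieldType) (q : nat).

(* The basis vector |0> of C^q. *)
Definition ket0 : hilbert C 'I_q := [ffun i : 'I_q => (i == 0 :> nat)%:R].

(* The maximally entangled pair Phi. *)
Definition max_entangled : hilbert C ('I_q * 'I_q)%type :=
  [ffun z : 'I_q * 'I_q => (sqrtC q%:R)^-1 * (z.1 == z.2)%:R].

Section InitialState.
Variables (n k a c : nat) (e : (k + a + c)%N = n).

(* The sender's n qudits are, in this order, the k data qudits, the a ancillas
   and the sender's halves of the c entangled pairs. *)
Definition data_part (x : word q n) : word q k :=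
  [ffun i => x (cast_ord e (lshift c (lshift a i)))].
Definition ancilla_part (x : word q n) : word q a :=
  [ffun i => x (cast_ord e (lshift c (rshift k i)))].
Definition pair_part (x : word q n) : word q c :=
  [ffun i => x (cast_ord e (rshift (k + a) i))].

(* |psi> (x) |0>^(x)a (x) Phi^(x)c: z.1 labels the sender's n qudits and z.2
   the receiver's c halves. *)
Definition initial_state (psi : hilbert C (word q k)) :
    hilbert C (word q n * word q c) :=
  [ffun z : word q n * word q c =>
     psi (data_part z.1)
     * tensor_power a ket0 (ancilla_part z.1)
     * tensor_power c max_entangled [ffun i => (pair_part z.1 i, z.2 i)]].

End InitialState.

(* Q is an [[n,k,d;c]]_q code.  The equation e forces a = n - k - c, and
   #|S| < d says "at most d - 1 qudits".  The condition is monotone in d: it does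
   not ask d to be the largest value for which it holds. *)
Definition is_EAQECC (n k d c : nat)
    (Q : {vspace hilbert C (word q n * word q c)}) : Prop :=
  exists (a : nat) (e : (k + a + c)%N = n)
         (U : 'End(hilbert C (word q n)))
         (P : 'End(hilbert C (word q n * word q c))),
    [/\ unitary U,
        forall v, v \in Q <->
          exists psi : hilbert C (word q k),
            v = tensor_id (word q c) U (initial_state e psi),
        orthogonal_projector Q P &
        forall (E : 'End(hilbert C (word q n))) (S : {set 'I_n}),
          (#|S| < d)%N -> acts_within S E ->
          exists lam : C, (P \o tensor_id (word q c) E \o P)%VF = lam *: P].

End EAQECC.

Arguments is_EAQECC {C} q n k d c Q.

(* Main.v *)
(* The [[n+c, 2k-n]] code is the CSS code of C tensored with c untouched
   entangled pairs.  Let D be the dual of C.  For representatives x_s of C / D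
   and a basis label y of the sender's halves, the states
   |D|^(-1/2) \sum_(w in D) |x_s + w>|y> are orthonormal.  An error supported on
   fewer than d positions cannot connect two distinct words of C, so it has no
   matrix elements between different s.  Since C is the dual of D, the
   restriction of D to fewer than d positions is onto; translating the sum by a
   word of D agreeing with x_s there shows that the diagonal matrix elements do
   not depend on s.  These are the Knill-Laflamme conditions for distance d, and
   is_EAQECC only asks for a lower bound on the distance, so d' = d works. *)

Require Import Defs.
From HB Require Import structures.
From mathcomp Require Import all_boot all_order all_algebra.
From mathcomp Require Import complex reals.
From mathcomp Require Import ring.

Set Implicit Arguments.
Unset Strict Implicit.
Unset Printing Implicit Defensive.

Import Order.TTheory GRing.Theory Num.Theory.
Local Open Scope ring_scope.

(** * Inner products, basis kets and unitaries with prescribed orthonormal images *)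

Section InnerProduct.
Variables (C : numClosedFieldType) (X : finType).
Implicit Types (f g v w : hilbert C X) (A : 'End(hilbert C X)).

Lemma inner_conj f g : inner g f = (inner f g)^*.
Proof.
rewrite /inner rmorph_sum; apply: eq_bigr => x _.
by rewrite rmorphM /= conjCK mulrC.
Qed.

Lemma inner_linear v : linear (inner v : hilbert C X -> C^o).
Proof.
move=> a f g; rewrite /inner scaler_sumr -big_split; apply: eq_bigr => x _ /=.
by rewrite !ffunE mulrDr /GRing.scale /= mulrCA.
Qed.

Lemma innerDr v f g : inner v (f + g) = inner v f + inner v g.
Proof. by have := inner_linear v 1 f g; rewrite !scale1r. Qed.

Lemma innerZr v a f : inner v (a *: f) = a * inner v f.
Proof.
rewrite /inner mulr_sumr; apply: eq_bigr => x _.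
by rewrite ffunE mulrCA.
Qed.

Lemma innerNr v f : inner v (- f) = - inner v f.
Proof. by rewrite -scaleN1r innerZr mulN1r. Qed.

Lemma inner_sumr v (I : Type) (s : seq I) (P : pred I) (f : I -> hilbert C X) :
  inner v (\sum_(i <- s | P i) f i) = \sum_(i <- s | P i) inner v (f i).
Proof.
rewrite /inner exchange_big; apply: eq_bigr => x _.
by rewrite sum_ffunE mulr_sumr.
Qed.

Lemma innerDl v f g : inner (f + g) v = inner f v + inner g v.
Proof.
by rewrite inner_conj innerDr rmorphD [inner f v]inner_conj [inner g v]inner_conj.
Qed.

Lemma innerZl v a f : inner (a *: f) v = a^* * inner f v.
Proof. by rewrite inner_conj innerZr rmorphM [inner f v]inner_conj. Qed.

Lemma innerNl v f : inner (- f) v = - inner f v.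
Proof. by rewrite inner_conj innerNr rmorphN [inner f v]inner_conj. Qed.

Lemma inner_suml v (I : Type) (s : seq I) (P : pred I) (f : I -> hilbert C X) :
  inner (\sum_(i <- s | P i) f i) v = \sum_(i <- s | P i) inner (f i) v.
Proof.
rewrite inner_conj inner_sumr rmorph_sum.
by apply: eq_bigr => i _; rewrite [RHS]inner_conj.
Qed.

Lemma inner_eq0 f : (inner f f == 0) = (f == 0).
Proof.
apply/eqP/eqP => [f0 | ->]; last first.
  by rewrite /inner big1 // => x _; rewrite ffunE mulr0.
have f_ge0 x : xpredT x -> 0 <= (f x)^* * f x by rewrite mulrC mul_conjC_ge0.
apply/ffunP => x; rewrite ffunE; apply/eqP.
by rewrite -mul_conjC_eq0 mulrC; apply/eqP/(psumr_eq0P f_ge0 f0).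
Qed.

Definition ket (x : X) : hilbert C X := [ffun y => (y == x)%:R].

Lemma inner_ketl x f : inner (ket x) f = f x.
Proof.
rewrite /inner (bigD1 x) //= big1 => [|y /negPf xy]; rewrite ffunE.
  by rewrite eqxx conjC1 mul1r addr0.
by rewrite xy conjC0 mul0r.
Qed.

Lemma ket_expansion f : f = \sum_x f x *: ket x.
Proof.
apply/ffunP => x; rewrite sum_ffunE (bigD1 x) //= big1 => [|y /negPf xy].
  by rewrite !ffunE eqxx /GRing.scale /= mulr1 addr0.
by rewrite !ffunE eq_sym xy /GRing.scale /= mulr0.
Qed.

(** Definiteness of the inner product makes an isometry injective; in finite dimension, rank-nullity
    then makes it onto. *)
Lemma isometry_unitary A :
  (forall f g, inner (A f) (A g) = inner f g) -> unitary A.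
Proof.
move=> isoA; split=> //; apply/eqP.
rewrite eqEdim subvf -[X in (X <= _)%N](limg_ker_dim A fullv).
suff /eqP->: lker A == 0%VS by rewrite capv0 dimv0 add0n leqnn.
apply/lker0P => f g Afg; apply/eqP.
by rewrite -subr_eq0 -inner_eq0 -isoA linearB /= Afg subrr inner_eq0.
Qed.

Definition ketbra_fun v w f : hilbert C X := inner w f *: v.

Fact ketbra_fun_linear v w : linear (ketbra_fun v w).
Proof.
by move=> a f g; rewrite /ketbra_fun innerDr innerZr scalerDl scalerA.
Qed.
HB.instance Definition _ v w :=
  GRing.isLinear.Build C (hilbert C X) (hilbert C X) _
    (ketbra_fun v w) (ketbra_fun_linear v w).

Definition ketbra v w : 'End(hilbert C X) := linfun (ketbra_fun v w).

Lemma ketbraE v w f : ketbra v w f = inner w f *: v.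
Proof. by rewrite lfunE. Qed.

(* When <u, b> is real this is the Householder reflection exchanging u and b;
   the factor 1 / <w, u> in place of 2 / <w, w> supplies the missing phase. *)
Lemma unitary_transport u b : inner u u = 1 -> inner b b = 1 ->
  exists A, [/\ unitary A, A u = b &
    forall f, inner u f = 0 -> inner b f = 0 -> A f = f].
Proof.
move=> u1 b1; have [<-|neq_ub] := eqVneq u b.
  exists \1%VF; split=> [||f _ _]; rewrite ?id_lfunE //.
  by apply: isometry_unitary => f g; rewrite !id_lfunE.
pose w := u - b; pose s := inner w u.
(* This holds because [u] and [b] are unit vectors; it yields [s != 0], and it is the only fact
   about [w] and [s] that the isometry computation adds to that. *)
have ww : inner w w = s + s^*.
  rewrite {}/s -inner_conj /w !(innerDl, innerDr, innerNl, innerNr) u1 b1.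
  by rewrite (inner_conj u b); ring.
have s0 : s != 0.
  apply: contraNneq neq_ub => s0.
  by rewrite -subr_eq0 -inner_eq0 ww s0 conjC0 addr0.
exists (\1 - s^-1 *: ketbra w w)%VF.
have AE f : (\1 - s^-1 *: ketbra w w)%VF f = f - (s^-1 * inner w f) *: w.
  by rewrite add_lfunE opp_lfunE id_lfunE scale_lfunE ketbraE scalerA.
split=> [||f uf bf]; last 2 first.
- by rewrite AE mulVf // scale1r /w opprB addrC subrK.
- by rewrite AE /w innerDl innerNl uf bf subrr mulr0 scale0r subr0.
clearbody s w; apply: isometry_unitary => f g; rewrite !AE.
rewrite !(innerDl, innerDr, innerNl, innerNr, innerZl, innerZr) ww.
rewrite (inner_conj w f) !rmorphM fmorphV /=.
by field; rewrite conjC_eq0 s0.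
Qed.

Lemma unitary_comp A B : unitary A -> unitary B -> unitary (A \o B)%VF.
Proof.
move=> [isoA _] [isoB _]; apply: isometry_unitary => f g.
by rewrite !comp_lfunE isoA isoB.
Qed.

(** Induction on a list of indices: [unitary_transport] moves the current image of the next ket to
    its target and fixes the targets already reached, which are orthogonal to both vectors. *)
Lemma unitary_extension (I : finType) (j : I -> X) (b : I -> hilbert C X) :
    injective j -> (forall i i', inner (b i) (b i') = (i == i')%:R) ->
  exists2 U, unitary U & forall i, U (ket (j i)) = b i.
Proof.
move=> j_inj b_on.
suff: forall s : seq I, uniq s ->
    exists2 U, unitary U & {in s, forall i, U (ket (j i)) = b i}.
  case/(_ _ (enum_uniq I)) => U uU Ub.
  by exists U => // i; rewrite Ub ?mem_enum.
elim=> [_|i s IHs /= /andP[i_s /IHs[U [isoU oU] Ub]]].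
  by exists \1%VF => //; apply: isometry_unitary => f g; rewrite !id_lfunE.
have u1 : inner (U (ket (j i))) (U (ket (j i))) = 1.
  by rewrite isoU inner_ketl ffunE eqxx.
have b1 : inner (b i) (b i) = 1 by rewrite b_on eqxx.
have [A [uA Aub Afix]] := unitary_transport u1 b1.
exists (A \o U)%VF => [|i' /predU1P[-> //|i's]]; first exact: unitary_comp.
  by rewrite comp_lfunE.
have i'i : (i == i') = false by apply: contraNF i_s => /eqP->.
rewrite comp_lfunE (Ub i' i's) Afix //; last by rewrite b_on i'i.
by rewrite -(Ub i' i's) isoU inner_ketl ffunE (inj_eq j_inj) i'i.
Qed.

End InnerProduct.

(** * Codes encoded from an orthonormal family on the sender's side *)

Section EncodingCriterion.
Variables (C : numClosedFieldType) (q k a c n : nat) (e : (k + a + c)%N = n).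

Section Slices.
Variables (X Y : finType).
Implicit Types (f g : hilbert C (X * Y)).

Definition slice f (y : Y) : hilbert C X := [ffun x => f (x, y)].

Lemma inner_slice f g : inner f g = \sum_y inner (slice f y) (slice g y).
Proof.
rewrite /inner exchange_big pair_big /=; apply: eq_bigr => -[x y] _.
by rewrite !ffunE.
Qed.

Lemma slice_tensor_id A f y : slice (tensor_id Y A f) y = A (slice f y).
Proof. by apply/ffunP => x; rewrite ffunE tensor_idE. Qed.

End Slices.

Lemma prodr_natr_bool (I : finType) (P : pred I) :
  \prod_i (P i)%:R = [forall i, P i]%:R :> C.
Proof.
have andM : {morph (fun b : bool => b%:R : C) : x y / x && y >-> x * y}.
  by move=> x y; rewrite -natrM mulnb.
rewrite -(big_morph _ andM (erefl (1 : C) : true%:R = 1 :> C)) big_andE.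
by congr _%:R; apply: eq_forallb => i.
Qed.

Hypothesis q_gt0 : (0 < q)%N.

Definition encoder_input (p : word q k * word q c) : word q n :=
  [ffun i => match split (cast_ord (esym e) i) with
    | inl i' => if split i' is inl i'' then p.1 i'' else Ordinal q_gt0
    | inr i' => p.2 i'
    end].

Lemma encoder_input_eq x s y :
  (x == encoder_input (s, y)) =
  [&& data_part e x == s, [forall i, ancilla_part e x i == 0 :> nat]
    & pair_part e x == y].
Proof.
apply/eqP/and3P => [->|[/eqP<- /forallP anc /eqP<-]].
  split.
  - apply/eqP/ffunP => i; rewrite !ffunE cast_ordK.
    by rewrite (unsplitK (inl (lshift a i))) (unsplitK (inl i)).
  - apply/forallP => i; rewrite !ffunE cast_ordK.
    by rewrite (unsplitK (inl (rshift k i))) (unsplitK (inr i)).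
  - by apply/eqP/ffunP => i; rewrite !ffunE cast_ordK (unsplitK (inr i)).
apply/ffunP => i; rewrite ffunE -(cast_ordKV e i) cast_ordK.
case: (split_ordP (cast_ord (esym e) i)) => j ->; last by rewrite ffunE.
case: (split_ordP j) => t ->; rewrite ?ffunE //.
by apply/val_inj/eqP; move: (anc t); rewrite ffunE.
Qed.

Lemma encoder_input_inj : injective encoder_input.
Proof.
move=> [s y] [s' y'] /eqP; rewrite encoder_input_eq => /and3P[/eqP<- _ /eqP<-].
have := eqxx (encoder_input (s, y)).
by rewrite encoder_input_eq => /and3P[/eqP-> _ /eqP->].
Qed.

Let r : C := (sqrtC q%:R)^-1 ^+ c.

(** Nonzero amplitude requires zero ancillas and, by maximal entanglement, sender's halves equal to
    [y]; [r] collects the normalisations of the [c] pairs. *)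
Lemma initial_state_slice psi y :
  slice (initial_state e psi) y =
  \sum_s (r * psi s) *: ket C (encoder_input (s, y)).
Proof.
apply/ffunP => x; rewrite sum_ffunE !ffunE /tensor_power /=.
under eq_bigr do rewrite ffunE.
under [X in _ * X]eq_bigr do rewrite !ffunE /=.
rewrite prodr_natr_bool big_split /= prodr_const card_ord prodr_natr_bool.
have -> : [forall i, x (cast_ord e (rshift (k + a) i)) == y i] =
    (pair_part e x == y).
  apply/forallP/eqP => [xy | <- i]; last by rewrite ffunE.
  by apply/ffunP => i; rewrite ffunE; apply/eqP.
rewrite (bigD1 (data_part e x)) //= big1 ?addr0 => [|s /negPf sx].
  rewrite !ffunE encoder_input_eq eqxx /= /GRing.scale /= -mulnb natrM -/r.
  by ring.
by rewrite !ffunE encoder_input_eq eq_sym sx /GRing.scale /= mulr0.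
Qed.

Variable b : word q k * word q c -> hilbert C (word q n).
Hypothesis b_on : forall p p', inner (b p) (b p') = (p == p')%:R.

(** The code state for the data label [s]: what a unitary sending each ket of [encoder_input p] to
    [b p] makes of the initial state. *)
Definition encoded s : hilbert C (word q n * word q c) :=
  [ffun z => r * b (s, z.2) z.1].

Lemma slice_encoded s y : slice (encoded s) y = r *: b (s, y).
Proof. by apply/ffunP => x; rewrite !ffunE. Qed.

(** [E] leaves the receiver's label alone, so only equal labels [y] pair up; the prefactor is
    [r^* * r]. *)
Lemma encoded_matrix_element (E : 'End(hilbert C (word q n))) s s' :
  inner (encoded s) (tensor_id (word q c) E (encoded s')) =
  (q%:R ^- c) * \sum_y inner (b (s, y)) (E (b (s', y))).
Proof.
rewrite inner_slice mulr_sumr; apply: eq_bigr => y _.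
rewrite slice_tensor_id !slice_encoded linearZ innerZl innerZr mulrA.
congr (_ * _); rewrite /r rmorphXn /= fmorphV /= conj_Creal; last first.
  by rewrite ger0_real // sqrtC_ge0 ler0n.
by rewrite -exprMn -invfM -expr2 sqrtCK exprVn.
Qed.

(** The matrix element of the identity: the [q ^ c] receiver labels cancel the prefactor. *)
Lemma encoded_orthonormal s s' : inner (encoded s) (encoded s') = (s == s')%:R.
Proof.
rewrite (_ : encoded s' = tensor_id (word q c) \1%VF (encoded s')); last first.
  by apply/ffunP => -[x y]; rewrite tensor_idE id_lfunE ffunE.
rewrite encoded_matrix_element.
under eq_bigr do rewrite id_lfunE b_on xpair_eqE eqxx andbT.
rewrite sumr_const card_ffun !card_ord -[X in _ * X]mulr_natl mulrA natrX.
rewrite mulVf ?mul1r //.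
by rewrite expf_neq0 // pnatr_eq0 -lt0n.
Qed.

(* The hypothesis is the Knill-Laflamme condition on the sender's side, for a
   fixed value y of the receiver's halves. *)
Lemma is_EAQECC_of_orthonormal d :
    (forall (E : 'End(hilbert C (word q n))) (S : {set 'I_n}),
      (#|S| < d)%N -> acts_within S E ->
      forall y, exists lam, forall s s',
        inner (b (s, y)) (E (b (s', y))) = lam * (s == s')%:R) ->
  exists Q, is_EAQECC (C := C) q n k d c Q.
Proof.
move=> KL.
have [U uU Ub] := unitary_extension encoder_input_inj b_on.
have encE psi : tensor_id (word q c) U (initial_state e psi) =
    \sum_s psi s *: encoded s.
  apply/ffunP => -[x y]; rewrite sum_ffunE.
  have /ffunP/(_ x) := slice_tensor_id U (initial_state e psi) y.
  rewrite ffunE => ->; rewrite initial_state_slice linear_sum sum_ffunE.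
  apply: eq_bigr => s _; rewrite linearZ /= Ub !ffunE /GRing.scale /=.
  by ring.
pose P := \sum_s ketbra (encoded s) (encoded s).
have PE f : P f = \sum_s inner (encoded s) f *: encoded s.
  by rewrite sum_lfunE; apply: eq_bigr => s _; rewrite ketbraE.
have Penc s : P (encoded s) = encoded s.
  rewrite PE (bigD1 s) //= big1 => [|s' /negPf s's].
    by rewrite encoded_orthonormal eqxx scale1r addr0.
  by rewrite encoded_orthonormal s's scale0r.
exists (limg P), a, e, U, P; split=> // [v|| E S ltSd ES].
- split=> [/memv_imgP[f _ ->]|[psi ->]].
    exists [ffun s => inner (encoded s) f]; rewrite encE PE.
    by apply: eq_bigr => s _; rewrite ffunE.
  rewrite encE memv_suml // => s _; rewrite memvZ // -Penc memv_img //.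
  exact: memvf.
- split=> // [|f g].
    apply/lfunP => f; rewrite comp_lfunE [P f]PE linear_sum.
    by apply: eq_bigr => s _; rewrite linearZ /= Penc.
  rewrite !PE inner_suml inner_sumr; apply: eq_bigr => s _.
  by rewrite innerZl innerZr -inner_conj mulrC.
have /fin_all_exists[lam lamE] := KL E S ltSd ES.
(* The scalar may vary with [y] on the sender's side; the code sees its mean over the [q ^ c]
   receiver labels. *)
exists (q%:R ^- c * \sum_y lam y); apply/lfunP => f.
rewrite !comp_lfunE scale_lfunE !PE scaler_sumr.
apply: eq_bigr => s _; rewrite !linear_sum inner_sumr (bigD1 s) //=.
rewrite big1 ?addr0 => [|s' /negPf s's]; last first.
  rewrite linearZ innerZr encoded_matrix_element big1 ?mulr0 // => y _.
  by rewrite lamE eq_sym s's mulr0.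
rewrite linearZ innerZr encoded_matrix_element scalerA.
congr (_ *: _); rewrite mulrC; congr (_ * _ * _).
by apply: eq_bigr => y _; rewrite lamE eqxx mulr1.
Qed.

End EncodingCriterion.

(** * Euclidean duals: dimension, biduality, interpolation *)

Section DualCode.
Variables (F : finFieldType) (n : nat).
Implicit Types (C D V : {vspace 'rV[F]_n}) (v w : 'rV[F]_n).

Lemma dual_codeP C v :
  reflect (forall w, w \in C -> v *m w^T = 0) (v \in dual_code C).
Proof.
apply: (iffP (mem_dual_code C v)) => vC w /vC.
  move=> vw; apply/rowP => i; rewrite ord1 !mxE -[RHS]vw.
  by apply: eq_bigr => j _; rewrite mxE.
move/rowP=> /(_ ord0); rewrite !mxE => vw; rewrite -[RHS]vw.
by apply: eq_bigr => j _; rewrite mxE.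
Qed.

(** The dual is the kernel of multiplication by [B^T], where the rows of [B] form a basis of [V].
    Full row rank of [B] makes this map onto, and rank-nullity concludes. *)
Lemma dim_dual_code V : \dim (dual_code V) = (n - \dim V)%N.
Proof.
pose B := \matrix_(i < \dim V) (vbasis V)`_i.
pose f : 'Hom('rV[F]_n, 'rV[F]_(\dim V)) := linfun (mulmxr B^T).
have freeB : row_free B.
  rewrite -kermx_eq0; apply/rowV0P => u /sub_kermxP uB0.
  have := basis_free (vbasisP V); move/freeP => /(_ (fun i => u 0 i)) u0.
  apply/rowP => i; rewrite mxE u0 // -[RHS]uB0 mulmx_sum_row.
  by apply: eq_bigr => {}i _; rewrite rowK.
have ->: dual_code V = lker f.
  apply/vspaceP => v; rewrite memv_ker lfunE /=.
  apply/dual_codeP/eqP => [vV | vB w wV].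
    apply/rowP => i; rewrite !mxE.
    have iV : (vbasis V)`_i \in V by rewrite vbasis_mem ?mem_nth ?size_tuple.
    move/rowP: (vV _ iV) => /(_ ord0); rewrite !mxE => vi; rewrite -[RHS]vi.
    by apply: eq_bigr => j _; rewrite !mxE.
  rewrite (coord_vbasis wV) linear_sum mulmx_sumr big1 // => i _.
  rewrite linearZ -scalemxAr /=.
  suff ->: v *m ((vbasis V)`_i)^T = 0 by rewrite scaler0.
  apply/rowP => z; rewrite ord1; move/rowP: vB => /(_ i); rewrite !mxE => vB.
  by rewrite -[RHS]vB; apply: eq_bigr => j _; rewrite !mxE.
have limf : limg f = fullv.
  apply/eqP; rewrite eqEsubv subvf; apply/subvP => y _.
  have /submxP[x ->] : (y <= B^T)%MS.
    by apply: submx_full; rewrite /row_full mxrank_tr.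
  suff -> : x *m B^T = f x by apply: memv_img; apply: memvf.
  by rewrite lfunE.
have := limg_ker_dim f fullv; rewrite capfv limf !dimvf /dim /= !mul1n => dimf.
by rewrite -[LHS](addnK (\dim V)) dimf.
Qed.

(** Symmetry of the form gives one inclusion, and the dimensions agree. *)
Lemma dual_codeK C : dual_code (dual_code C) = C.
Proof.
apply/esym/eqP; rewrite eqEdim !dim_dual_code subKn ?leqnn ?andbT; last first.
  by have := dimvS (subvf C); rewrite dimvf /dim /= mul1n.
apply/subvP => v vC; apply/mem_dual_code => w /mem_dual_code/(_ v vC) wv.
by rewrite -[RHS]wv; apply: eq_bigr => i _; rewrite mulrC.
Qed.

(* The dual code is an orthogonal array of strength d - 1: a vector orthogonal to
   it and supported on S would be a word of C of weight < d. *)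
Lemma dual_code_interpolation C d (S : {set 'I_n}) v :
    min_distance C d -> (#|S| < d)%N ->
  exists2 w, w \in dual_code C & {in S, forall i, w 0 i = v 0 i}.
Proof.
move=> [_ dC] ltSd.
(* [Z] is the space of vectors vanishing on [S], so it suffices that [dual_code C + Z] is the full
   space, that is, has zero dual. *)
pose Z := (\sum_(i | i \notin S) <[delta_mx ord0 i : 'rV[F]_n]>)%VS.
have DZ0 : dual_code (dual_code C + Z) = 0%VS.
  apply/eqP; rewrite -subv0; apply/subvP => u /mem_dual_code uDZ.
  have uC : u \in C.
    rewrite -(dual_codeK C); apply/mem_dual_code => w wD.
    by apply: uDZ; apply: subvP wD; apply: addvSl.
  have uS i : i \notin S -> u 0 i = 0.
    move=> iS; have iZ : delta_mx ord0 i \in (dual_code C + Z)%VS.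
      apply: (subvP (addvSr _ _)); apply: (subvP (sumv_sup i _ _)) => //.
      exact: memv_line.
    rewrite -[RHS](uDZ _ iZ) (bigD1 i) //= big1 => [|j /negPf ji].
      by rewrite mxE !eqxx mulr1 addr0.
    by rewrite mxE ji andbF mulr0.
  rewrite memv0; apply: contraLR ltSd => u0; rewrite -leqNgt.
  apply: leq_trans (dC u 0 uC (mem0v _) u0) (subset_leq_card _).
  by apply/subsetP => i; rewrite inE mxE; apply: contraR => /uS/eqP.
have DZ : (dual_code C + Z)%VS = fullv.
  apply/eqP; rewrite eqEdim subvf dimvf /dim /= mul1n -subn_eq0.
  by rewrite -dim_dual_code DZ0 dimv0.
have /memv_addP[w wD [z zZ ->]] : v \in (dual_code C + Z)%VS.
  by rewrite DZ memvf.
exists w => // i iS; rewrite mxE; case/memv_sumP: zZ => g gZ ->.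
rewrite summxE big1 ?addr0 // => j jS; have /vlineP[a ->] := gZ j jS.
by rewrite !mxE [i == j](contraNF _ jS) ?mulr0 // => /eqP <-.
Qed.

End DualCode.

(** The representatives are combinations of a basis of a complement [K] of [D] in [C], with
    coefficients read through [phi]. A difference in [D] also lies in [K], hence vanishes, and
    freeness gives back the label. *)
Lemma coset_representatives (F : finFieldType) (n m : nat) (T : eqType)
    (phi : T -> F) (C D : {vspace 'rV[F]_n}) :
    injective phi -> (D <= C)%VS -> m = (\dim C - \dim D)%N ->
  exists x : {ffun 'I_m -> T} -> 'rV[F]_n,
    (forall s, x s \in C) /\ (forall s s', x s - x s' \in D -> s = s').
Proof.
move=> phi_inj DC mE; pose K := (C :\: D)%VS.
have {mE} mE : m = \dim K.
  by rewrite mE -(dimv_cap_compl C D) (capv_idPr DC) addKn.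
subst m; exists (fun s => \sum_(i < \dim K) phi (s i) *: (vbasis K)`_i).
have mem_basis (i : 'I_(\dim K)) : (vbasis K)`_i \in K.
  by rewrite vbasis_mem ?mem_nth ?size_tuple.
split=> [s | s s'].
  by apply: subvP (diffvSl C D) _ _; rewrite memv_suml // => i _; rewrite memvZ.
rewrite -sumrB; under eq_bigr do rewrite -scalerBl.
set v := (X in X \in D) => vD.
have v0 : v = 0.
  apply/eqP; rewrite -memv0 -(capv_diff C D) memv_cap vD andbT.
  by rewrite memv_suml // => i _; rewrite memvZ.
have /freeP freeK := basis_free (vbasisP K).
have ss' := freeK (fun i => phi (s i) - phi (s' i)) v0.
by apply/ffunP => i; apply/phi_inj/eqP; rewrite -subr_eq0 ss'.
Qed.

(** * Matrix entries of local operators in the computational basis *)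

Section LocalKets.
Variables (C : numClosedFieldType) (q n : nat) (S : {set 'I_n}).
Variable A : 'End(hilbert C (subword q S)).

Lemma local_op_ket_offdiag x y :
  local_op A (ket C y) x != 0 -> forall i, i \notin S -> x i = y i.
Proof.
move=> Axy i iS; apply: contraNeq Axy => xyi.
rewrite local_opE (_ : [ffun u => _] = 0) ?linear0 ?ffunE //.
apply/ffunP => u; rewrite !ffunE (_ : _ == y = false) //.
apply: contraNF xyi => /eqP<-; rewrite ffunE insubF //.
exact: negPf.
Qed.

(** The entry sees [x] only through its letters in [S]; this is what will make diagonal entries
    invariant under changes outside [S]. *)
Lemma local_op_ket_diag x :
  local_op A (ket C x) x = A (ket C (subword_of S x)) (subword_of S x).
Proof.
rewrite local_opE; congr (fun_of_fin (A _) _); apply/ffunP => u; rewrite !ffunE.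
congr (nat_of_bool _)%:R.
apply/eqP/eqP => [<-|->]; apply/ffunP => i; rewrite ffunE.
  by rewrite ffunE valK.
by case: insubP => [j _ <-|//]; rewrite ffunE.
Qed.

End LocalKets.

(** * Coset states of the CSS code and their Knill-Laflamme conditions *)

Section CSSFamily.
Variables (C : numClosedFieldType) (F : finFieldType) (q : nat).
Variables (letter : F -> 'I_q) (letter_inj : injective letter).
Variables (n k c d : nat) (B D : {vspace 'rV[F]_n}).
Variable x : word q k -> 'rV[F]_n.
Hypotheses (DB : (D <= B)%VS) (xB : forall s, x s \in B).
Hypothesis x_inj : forall s s', x s - x s' \in D -> s = s'.

Definition joint_word (v : 'rV[F]_n) (y : word q c) : word q (n + c)%N :=
  [ffun i => match split i with inl j => letter (v 0 j) | inr j => y j end].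

Lemma joint_word_inj v v' y y' :
  joint_word v y = joint_word v' y' -> v = v' /\ y = y'.
Proof.
move=> /ffunP eq_vy; split.
  apply/rowP => i; move: (eq_vy (lshift c i)).
  by rewrite !ffunE (unsplitK (inl i)) => /letter_inj.
apply/ffunP => i; move: (eq_vy (rshift n i)).
by rewrite !ffunE (unsplitK (inr i)).
Qed.

Let r : C := (sqrtC #|[pred w | w \in D]|%:R)^-1.

Definition coset_state (p : word q k * word q c) :
    hilbert C (word q (n + c)%N) :=
  r *: \sum_(w in D) ket C (joint_word (x p.1 + w) p.2).

Lemma coset_eq s s' w w' : w \in D -> w' \in D ->
  x s + w = x s' + w' -> s = s' /\ w = w'.
Proof.
move=> wD w'D eq_xw; have ss' : s = s'.
  apply: x_inj; have -> : x s - x s' = w' - w.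
    by apply/eqP; rewrite subr_eq addrAC eq_sym subr_eq eq_xw addrC.
  exact: rpredB.
by split=> //; move: eq_xw; rewrite ss' => /addrI.
Qed.

Lemma coset_state_matrix_element (E : 'End(hilbert C (word q (n + c)%N))) p p' :
  inner (coset_state p) (E (coset_state p')) =
  #|[pred w | w \in D]|%:R^-1 * \sum_(w in D) \sum_(w' in D)
    E (ket C (joint_word (x p'.1 + w') p'.2)) (joint_word (x p.1 + w) p.2).
Proof.
rewrite /coset_state linearZ innerZl innerZr mulrA; congr (_ * _).
  rewrite /r fmorphV /= conj_Creal; last first.
    by rewrite ger0_real // sqrtC_ge0 ler0n.
  by rewrite -invfM -expr2 sqrtCK.
rewrite inner_suml; apply: eq_bigr => w _.
rewrite inner_ketl linear_sum sum_ffunE; exact: eq_bigr.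
Qed.

(** The matrix element of the identity: cosets with different labels are disjoint, and within one
    coset the diagonal terms cancel the normalisation. *)
Lemma coset_state_orthonormal p p' :
  inner (coset_state p) (coset_state p') = (p == p')%:R.
Proof.
rewrite -[coset_state p']id_lfunE coset_state_matrix_element.
have D_neq0 : #|[pred w | w \in D]|%:R != 0 :> C.
  rewrite pnatr_eq0 -lt0n; apply/card_gt0P; exists 0; exact: mem0v.
have [<-|] := eqVneq p p'; last first.
  case: p p' => [s y] [s' y'] neq_p; rewrite big1 ?mulr0 // => w wD.
  rewrite big1 // => w' w'D; rewrite id_lfunE ffunE.
  case: eqP => // /joint_word_inj[/= /(coset_eq wD w'D)[ss' _] yy'].
  by rewrite ss' yy' eqxx in neq_p.
rewrite (eq_bigr (fun=> 1)) => [|w wD]; first by rewrite sumr_const mulVf.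
rewrite (bigD1 w) //= id_lfunE ffunE eqxx big1 ?addr0 //.
move=> w' /andP[w'D neq_w]; rewrite id_lfunE ffunE.
case: eqP => // /joint_word_inj[/(coset_eq wD w'D)[_ ww'] _].
by rewrite ww' eqxx in neq_w.
Qed.

Lemma coset_state_knill_laflamme :
    (forall u v : 'rV[F]_n, u \in B -> v \in B -> u != v ->
      (d <= hamming_dist u v)%N) ->
    (forall (S : {set 'I_n}) (v : 'rV[F]_n), (#|S| < d)%N ->
      exists2 w, w \in D & {in S, forall i, w 0 i = v 0 i}) ->
  forall (E : 'End(hilbert C (word q (n + c)%N))) (S : {set 'I_(n + c)}),
    (#|S| < d)%N -> acts_within S E ->
  forall y, exists lam, forall s s',
    inner (coset_state (s, y)) (E (coset_state (s', y))) = lam * (s == s')%:R.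
Proof.
move=> distB interpD _ S ltSd [A ->] y.
(* Both words end with the same [y], so only the error positions among the first [n] matter. *)
pose S1 := [set i | lshift c i \in S].
have ltS1d : (#|S1| < d)%N.
  apply: leq_ltn_trans ltSd; rewrite -(card_imset _ (@lshift_inj n c)).
  by apply/subset_leq_card/subsetP => _ /imsetP[i iS ->]; rewrite inE in iS.
pose h v := local_op A (ket C (joint_word v y)) (joint_word v y).
have hE (v v' : 'rV[F]_n) : {in S1, forall i, v 0 i = v' 0 i} -> h v = h v'.
  move=> vv'; rewrite /h !local_op_ket_diag.
  suff -> : subword_of S (joint_word v y) =
    subword_of S (joint_word v' y) by [].
  apply/ffunP => -[i iS]; rewrite !ffunE /=.
  by case: (split_ordP i) iS => j -> // jS; rewrite vv' // inE.
(* A nonzero entry would make two distinct words of [B] agree off [S1], hence lie at distance less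
   than [d]. *)
have offdiag s s' w w' : w \in D -> w' \in D -> x s + w != x s' + w' ->
    local_op A (ket C (joint_word (x s' + w') y)) (joint_word (x s + w) y) = 0.
  move=> wD w'D neq_xw; apply: contraTeq ltS1d.
  move/local_op_ket_offdiag => eqS; rewrite -leqNgt.
  have mem_xw t v : v \in D -> x t + v \in B.
    by move=> vD; rewrite rpredD // (subvP DB).
  apply: leq_trans (distB _ _ (mem_xw _ _ wD) (mem_xw _ _ w'D) neq_xw) _.
  apply/subset_leq_card/subsetP => i; rewrite !inE; apply: contraR => /eqS.
  by rewrite !ffunE (unsplitK (inl i)) => /letter_inj ->.
exists (#|[pred w | w \in D]|%:R^-1 * \sum_(w in D) h w) => s s'.
rewrite coset_state_matrix_element -mulrA; congr (_ * _); rewrite /=.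
have [<-|neq_s] := eqVneq s s'; last first.
  rewrite mulr0 big1 // => w wD; rewrite big1 // => w' w'D.
  apply: offdiag => //.
  by apply: contraNneq neq_s => /(coset_eq wD w'D)[ss' _]; rewrite ss'.
rewrite mulr1; have [w0 w0D w0x] := interpD S1 (x s) ltS1d.
(* Translation by [w0] permutes [D], and [w0 + w] agrees with [x s + w] on [S1], so the diagonal sum
   does not depend on [s]. *)
rewrite [RHS](reindex_inj (addrI w0)) /=.
apply: eq_big => [w|w wD]; first by rewrite rpredDl.
rewrite (bigD1 w) //= big1 ?addr0 => [|w' /andP[w'D neq_w]].
  by apply: hE => i iS; rewrite !mxE w0x.
by apply: offdiag => //; rewrite (inj_eq (addrI _)) eq_sym.
Qed.

End CSSFamily.

(* A finite field with q elements exists exactly when q is a prime power, and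
   2 * k - n is not truncated since the dual code has dimension n - k <= k. *)
Theorem proposition4p1 (R : realType) (q : nat) (F : finFieldType)
    (hq : (3 < q)%N) (hF : #|F| = q)
    (n k d l : nat) (C : {vspace 'rV[F]_n})
    (hC : linear_code k d C)
    (hdual : (dual_code C <= C)%VS)
    (hl : (\dim C - \dim (dual_code C))%N = l)
    (c : nat) (hc : (c <= l)%N) :
  exists d' : nat, (d <= d' <= d + c)%N /\
    exists Q : {vspace hilbert R[i] (word q (n + c)%N * word q c)},
      is_EAQECC q (n + c)%N (2 * k - n)%N d' c Q.
Proof.
exists d; rewrite leqnn leq_addr; split=> //.
case: hC => dimC dC; have le_kn : (k <= n)%N.
  by have := dimvS (subvf C); rewrite dimvf /dim /= mul1n dimC.
have dimD : (2 * k - n)%N = (\dim C - \dim (dual_code C))%N.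
  by rewrite dim_dual_code dimC subnBA // mul2n addnn.
(* The number of ancillas is [n - (2 * k - n)], not truncated since [k <= n]. *)
have e : (2 * k - n + (n - (2 * k - n)) + c)%N = (n + c)%N.
  by rewrite subnKC // leq_subLR mul2n -addnn leq_add.
have q_gt0 : (0 < q)%N by apply: leq_ltn_trans hq.
(* Qudit labels are numbers below [q]: [letter] writes field elements as labels, and its inverse
   [symbol] reads data labels as coefficients. *)
pose letter (u : F) : 'I_q := cast_ord hF (enum_rank u).
pose symbol (i : 'I_q) : F := enum_val (cast_ord (esym hF) i).
have letterK : cancel letter symbol.
  by move=> u; rewrite /symbol cast_ordK enum_rankK.
have symbolK : cancel symbol letter.
  by move=> i; rewrite /letter enum_valK cast_ordKV.
have [x [xC x_inj]] := coset_representatives (can_inj symbolK) hdual dimD.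
apply: (is_EAQECC_of_orthonormal e q_gt0).
- exact: (coset_state_orthonormal _ (can_inj letterK) x_inj).
- apply: (coset_state_knill_laflamme (can_inj letterK) hdual xC x_inj dC.2).
  by move=> S v; apply: dual_code_interpolation dC.
Qed.
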